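(* Let $d\ge 2$. For each $i=1,\dots,d$ let $A_i\in\mathbb{C}^{n_i\times n_i}$, $C_i\in\mathbb{C}^{n_i\times b_i}$, let $\boldsymbol{\xi}_i$ be a sequence of $k_i$ poles in $(\mathbb{C}\cup\{\infty\})\setminus\Lambda(A_i)$, let $V_i\in\mathbb{C}^{n_i\times b_ik_i}$ be an orthonormal block basis of the block rational Krylov subspace $\mathcal{Q}_{k_i}(A_i,C_i,\boldsymbol{\xi}_i)$, and put $A_i^{(k_i)}=V_i^HA_iV_i$. Let $\mathcal{C}\in\mathbb{C}^{n_1\times\cdots\times n_d}$ and let $\mathcal{Y}_{\boldsymbol{k}}\in\mathbb{C}^{b_1k_1\times\cdots\times b_dk_d}$ be a solution of the projected equation $$\mathcal{Y}_{\boldsymbol{k}}\times_1A_1^{(k_1)}+\dots+\mathcal{Y}_{\boldsymbol{k}}\times_dA_d^{(k_d)}=\mathcal{C}\times_1V_1^H\times_2\cdots\times_dV_d^H.$$ Let $c=\mathrm{vec}(\mathcal{C})$, $y=\mathrm{vec}(\mathcal{Y}_{\boldsymbol{k}})$, $\boldsymbol{V}=V_d\otimes\cdots\otimes V_1$, $$\boldsymbol{A}=\sum_{i=1}^d I_{n_d}\otimes\cdots\otimes I_{n_{i+1}}\otimes A_i\otimes I_{n_{i-1}}\otimes\cdots\otimes I_{n_1},$$ and let $r=c-\boldsymbol{A}\boldsymbol{V}y$ be the residual. For each $i$ define $$\overline{\boldsymbol{V}}_i=V_d\otimes\cdots\otimes V_{i+1}\otimes I_{n_i}\otimes V_{i-1}\otimes\cdots\otimes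 V_1,$$ let $\overline{\mathcal{C}}_i$ be the tensor obtained from $\mathcal{C}$ by applying the mode products $\times_jV_j^H$ for all $j\neq i$, let $\overline{\mathcal{Y}}^i_{\boldsymbol{k}}=\mathcal{Y}_{\boldsymbol{k}}\times_iV_i$, and let $$\mathcal{R}_i=\overline{\mathcal{C}}_i-\overline{\mathcal{Y}}^i_{\boldsymbol{k}}\times_iA_i-\sum_{j\ne i}\overline{\mathcal{Y}}^i_{\boldsymbol{k}}\times_jA_j^{(k_j)}.$$ Let $\hat{c}=\Big(\prod_{i=1}^d\big(I-\overline{\boldsymbol{V}}_i\overline{\boldsymbol{V}}_i^H\big)\Big)c$. Then $$\|r\|_2^2=\sum_{i=1}^d\|(\mathcal{R}_i)_{(i)}\|_F^2+\|\hat{c}\|_2^2,$$ where $(\mathcal{R}_i)_{(i)}$ denotes the mode-$i$ unfolding of $\mathcal{R}_i$. Moreover, $\hat{c}=0$ whenever $c$ belongs to the column span of $\boldsymbol{V}$.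
   Context: $\Lambda(A)$ is the spectrum of $A$, $A^H$ the conjugate transpose, $\otimes$ the Kronecker product, $\|\cdot\|_2$ the Euclidean norm and $\|\cdot\|_F$ the Frobenius norm. Mode product: for a tensor $\mathcal{X}\in\mathbb{C}^{m_1\times\cdots\times m_d}$ and a matrix $B\in\mathbb{C}^{p\times m_i}$, $\mathcal{X}\times_iB\in\mathbb{C}^{m_1\times\cdots\times m_{i-1}\times p\times m_{i+1}\times\cdots\times m_d}$ has entries $(\mathcal{X}\times_iB)_{s_1\dots s_d}=\sum_{t=1}^{m_i}\mathcal{X}_{s_1,\dots,s_{i-1},t,s_{i+1},\dots,s_d}B_{s_i,t}$. Vectorization: $\mathrm{vec}(\mathcal{X})$ lists the entries of $\mathcal{X}$ with the first index varying fastest, so that $\mathrm{vec}(\mathcal{X}\times_1B_1\times_2\cdots\times_dB_d)=(B_d\otimes\cdots\otimes B_1)\mathrm{vec}(\mathcal{X})$. Unfolding: the mode-$i$ unfolding $\mathcal{X}_{(i)}$ of $\mathcal{X}\in\mathbb{C}^{m_1\times\cdots\times m_d}$ is the $m_i\times\prod_{j\ne i}m_j$ matrix whose $j$th row lists all entries of $\mathcal{X}$ with $i$th index equal to $j$, ordered lexicographically in the remaining indices. Block rational Krylov subspace: for $A\in\mathbb{C}^{n\times n}$, $v\in\mathbb{C}^{n\times b}$ and a sequence $\boldsymbol{\xi}$ of $k$ poles in $(\mathbb{C}\cup\{\infty\})\setminus\Lambda(A)$, with $Q(z)=\prod_{\xi\in\boldsymbol{\xi},\,\xi\ne\infty}(z-\xi)$,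 $$\mathcal{Q}_k(A,v,\boldsymbol{\xi})=\Big\{Q(A)^{-1}\sum_{j=0}^{k-1}A^jv\,\Gamma_j:\ \Gamma_j\in\mathbb{C}^{b\times b}\Big\}\subseteq\mathbb{C}^{n\times b}.$$ Its block dimension is assumed to be full (standing assumption: the ''dimension'' is $kb$, i.e. the columns of its elements span a $kb$-dimensional subspace of $\mathbb{C}^n$). An orthonormal block basis is a matrix $V=[v_1,\dots,v_k]\in\mathbb{C}^{n\times bk}$ with orthonormal columns, with blocks $v_j \in \mathcal{Q}_k(A,v,\boldsymbol{\xi})$ of size $n\times b$, such that every element of $\mathcal{Q}_k(A,v,\boldsymbol{\xi})$ can be written as $\sum_{j=1}^kv_j\Gamma_j$ with $\Gamma_j\in\mathbb{C}^{b\times b}$. *)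

(* Defs.v *)
From HB Require Import structures.
From mathcomp Require Import all_boot all_order all_algebra.
From mathcomp Require Import spectral.
From mathcomp Require Export reals.
From mathcomp Require Export complex mxtens.

Set Implicit Arguments.
Unset Strict Implicit.
Unset Printing Implicit Defensive.

Import GRing.Theory Num.Theory.
Local Open Scope ring_scope.
Local Open Scope sesquilinear_scope.

(* Modes are indexed by ['I_d] (mode 1 of the usual numbering is [ord0]) and
   [m : 'I_d -> nat] lists the mode sizes. *)
Definition mindex (d : nat) (m : 'I_d -> nat) : finType :=
  {dffun forall j : 'I_d, 'I_(m j)}.

Definition tensor (C : Type) (d : nat) (m : 'I_d -> nat) : Type :=
  {ffun mindex m -> C}.

Definition set_size (d : nat) (m : 'I_d -> nat) (i : 'I_d) (p : nat) :
    'I_d -> nat :=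
  fun j => if j == i then p else m j.

Section Tensors.
Variable C : pzRingType.

(* Transport of a tensor along pointwise equal mode sizes, in the style of
   [conform_mx]: no equality proof appears in the term, and the result is only
   meaningful when [m] and [m'] agree pointwise ([u] is then unique). *)
Definition conform_tensor (d : nat) (m m' : 'I_d -> nat) (X : tensor C m) :
    tensor C m' :=
  [ffun s : mindex m' => \sum_(u : mindex m | [forall j, u j == s j :> nat]) X u].

(* The mode product [X x_i B], for [X] of sizes [m] and [B] of size [p x m i].
   The result has sizes [m'], where [m' i] is [p] and [m' j] is [m j] for
   [j != i]; these equations are often provable but not convertible, hence
   [conform_mx] and the comparison of indices as naturals.  The multi-indices
   [u] summed over are the [s_1,..,s_(i-1),t,s_(i+1),..,s_d], with [t = u i];
   see [mode_prodE]. *)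
Definition mode_prod (d : nat) (m m' : 'I_d -> nat) (i : 'I_d) (p q : nat)
    (B : 'M[C]_(p, q)) (X : tensor C m) : tensor C m' :=
  [ffun s : mindex m' =>
     \sum_(u : mindex m | [forall (j | j != i), u j == s j :> nat])
       X u * (conform_mx 0 B : 'M[C]_(m' i, m i)) (s i) (u i)].

(* [X x_(i1) B_(i1) x_(i2) B_(i2) ...] for [l = [:: i1; i2; ...]]. *)
Fixpoint mode_prods (d : nat) (m m' : 'I_d -> nat) (p q : 'I_d -> nat)
    (l : seq 'I_d) (B : forall j, 'M[C]_(p j, q j)) (X : tensor C m) :
    tensor C m' :=
  if l is i :: l' then
    mode_prods m' l' B (mode_prod (set_size m i (p i)) i (B i) X)
  else conform_tensor m' X.

Definition minsert (d : nat) (m : 'I_d -> nat) (i : 'I_d) (t : 'I_(m i))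
    (s : mindex (fun j : 'I_d.-1 => m (lift i j))) : mindex m :=
  [ffun j : 'I_d =>
     match unliftP i j with
     | UnliftSome k e => cast_ord (congr1 m (esym e)) (s k)
     | UnliftNone e => cast_ord (congr1 m (esym e)) t
     end].

Definition mindex0 (m : 'I_0 -> nat) : mindex m :=
  [ffun j : 'I_0 => False_rect _ (notF (ltn_ord j))].

(* [m_d * ... * m_1] *)
Fixpoint kron_size (d : nat) : ('I_d -> nat) -> nat :=
  if d is d'.+1 return ('I_d -> nat) -> nat then
    fun m => (kron_size (fun j : 'I_d' => m (lift ord0 j)) * m ord0)%N
  else fun=> 1%N.

(* [B_d *t ... *t B_1] *)
Fixpoint kron (d : nat) : forall (m n : 'I_d -> nat)
    (B : forall j, 'M[C]_(m j, n j)), 'M[C]_(kron_size m, kron_size n) :=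
  if d is d'.+1 return forall (m n : 'I_d -> nat)
    (B : forall j, 'M[C]_(m j, n j)), 'M[C]_(kron_size m, kron_size n) then
    fun m n B => tensmx (kron (fun j : 'I_d' => B (lift ord0 j))) (B ord0)
  else fun _ _ _ => 1%:M.

(* The second component of [mxtens_unindex] is the fastest one. *)
Fixpoint vec_mindex (d : nat) :
    forall m : 'I_d -> nat, 'I_(kron_size m) -> mindex m :=
  if d is d'.+1 return forall m : 'I_d -> nat, 'I_(kron_size m) -> mindex m then
    fun m a => minsert (m := m) (i := ord0) (mxtens_unindex a).2
      (vec_mindex (m := fun j : 'I_d' => m (lift ord0 j)) (mxtens_unindex a).1)
  else fun m _ => mindex0 m.

Definition vec (d : nat) (m : 'I_d -> nat) (X : tensor C m) :
    'cV[C]_(kron_size m) :=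
  \col_a X (vec_mindex a).

(* [m_1 * ... * m_d] *)
Fixpoint lex_size (d : nat) : ('I_d -> nat) -> nat :=
  if d is d'.+1 return ('I_d -> nat) -> nat then
    fun m => (m ord0 * lex_size (fun j : 'I_d' => m (lift ord0 j)))%N
  else fun=> 1%N.

(* The lexicographic enumeration of multi-indices (last index fastest). *)
Fixpoint lex_mindex (d : nat) :
    forall m : 'I_d -> nat, 'I_(lex_size m) -> mindex m :=
  if d is d'.+1 return forall m : 'I_d -> nat, 'I_(lex_size m) -> mindex m then
    fun m a => minsert (m := m) (i := ord0) (mxtens_unindex a).1
      (lex_mindex (m := fun j : 'I_d' => m (lift ord0 j)) (mxtens_unindex a).2)
  else fun m _ => mindex0 m.

Definition unfolding (d : nat) (m : 'I_d -> nat) (i : 'I_d) (X : tensor C m) :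
    'M[C]_(m i, lex_size (fun j : 'I_d.-1 => m (lift i j))) :=
  \matrix_(t, a) X (minsert t (lex_mindex a)).

End Tensors.

Arguments mode_prod {C d m m'} i {p q} B X.
Arguments mode_prods {C d m m' p q} l B X.
Arguments unfolding {C d m} i X.

Lemma mindexP d (m : 'I_d -> nat) (u v : mindex m) :
  (forall j, u j = v j :> nat) -> u = v.
Proof. by move=> h; apply/ffunP=> j; apply/val_inj/h. Qed.

Lemma conform_tensorE (C : pzRingType) d (m m' : 'I_d -> nat) (X : tensor C m)
  (s : mindex m') (u : mindex m) : (forall j, u j = s j :> nat) ->
  conform_tensor m' X s = X u.
Proof.
move=> h; rewrite ffunE (big_pred1 u) // => v /=.
apply/forallP/eqP => [e|-> j]; last by rewrite h.
by apply: mindexP => j; rewrite (eqP (e j)) h.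
Qed.

Lemma minsert_i d (m : 'I_d -> nat) i t s : @minsert d m i t s i = t.
Proof.
apply: val_inj; rewrite ffunE; case: unliftP => [k e|e] //=.
by move/eqP: e; rewrite (negbTE (neq_lift _ _)).
Qed.

Lemma minsert_lift d (m : 'I_d -> nat) i t s k : @minsert d m i t s (lift i k) = s k.
Proof.
apply: val_inj; rewrite ffunE; case: unliftP => [k' e|e] /=.
  by rewrite (lift_inj e).
by move/esym/eqP: e; rewrite (negbTE (neq_lift _ _)).
Qed.

Lemma kronE (C : comPzRingType) d (m n : 'I_d -> nat) (B : forall j, 'M[C]_(m j, n j)) a c :
  kron B a c = \prod_j B j (vec_mindex a j) (vec_mindex c j).
Proof.
elim: d m n B a c => [|d IH] m n B a c /=.
  by rewrite big_ord0 !ord1 mxE eqxx.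
rewrite mxE IH big_ord_recl mulrC !minsert_i; congr (_ * _).
by apply: eq_bigr => j _; rewrite !minsert_lift.
Qed.

Lemma vec_mindex_inj d (m : 'I_d -> nat) : injective (@vec_mindex d m).
Proof.
elim: d m => [|d IH] m a c; first by rewrite /= !ord1.
case: (mxtens_indexP a) => a1 a2; case: (mxtens_indexP c) => c1 c2.
cbn [vec_mindex]; rewrite !mxtens_indexK /= => /ffunP e.
have := e ord0; rewrite !minsert_i => ->; congr mxtens_index; congr pair; by apply: IH; apply/mindexP => j; have := congr1 val (e (lift ord0 j)); rewrite !minsert_lift /= => ->.
Qed.

Lemma kron_sizeE d (m : 'I_d -> nat) : kron_size m = (\prod_j m j)%N.
Proof.
by elim: d m => [|d IH] m /=; rewrite ?big_ord0 // big_ord_recl IH mulnC.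
Qed.
Lemma lex_sizeE d (m : 'I_d -> nat) : lex_size m = (\prod_j m j)%N.
Proof.
by elim: d m => [|d IH] m /=; rewrite ?big_ord0 // big_ord_recl IH.
Qed.

Lemma lex_mindex_inj d (m : 'I_d -> nat) : injective (@lex_mindex d m).
Proof.
elim: d m => [|d IH] m a c; first by rewrite /= !ord1.
case: (mxtens_indexP a) => a1 a2; case: (mxtens_indexP c) => c1 c2.
cbn [lex_mindex]; rewrite !mxtens_indexK /= => /ffunP e.
have := e ord0; rewrite !minsert_i => ->; congr mxtens_index; congr pair; by apply: IH; apply/mindexP => j; have := congr1 val (e (lift ord0 j)); rewrite !minsert_lift /= => ->.
Qed.

Lemma vec_mindex_bij d (m : 'I_d -> nat) : bijective (@vec_mindex d m).
Proof.
apply: inj_card_bij; first exact: vec_mindex_inj.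
rewrite card_ord kron_sizeE card_dep_ffun foldrE big_image /=.
by rewrite leq_eqVlt; apply/orP; left; apply/eqP; apply: eq_bigr => j _; rewrite card_ord.
Qed.

Lemma conformE (C : pzRingType) p q p' q' (B : 'M[C]_(p,q)) (ep : p = p') (eq : q = q')
   (a' : 'I_p') (c' : 'I_q') (a : 'I_p) (c : 'I_q) : a = a' :> nat -> c = c' :> nat ->
  (conform_mx 0 B : 'M_(p',q')) a' c' = B a c.
Proof.
subst => /val_inj -> /val_inj ->; by rewrite conform_mx_id.
Qed.


Lemma mode_prodE (C : pzRingType) d (m m' : 'I_d -> nat) (i : 'I_d) 
   (B : 'M[C]_(m' i, m i)) (X : tensor C m) (s : mindex m') (r : 'I_(m i) -> mindex m) :
   (forall t, r t i = t) -> (forall t j, j != i -> r t j = s j :> nat) ->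
   mode_prod i B X s = \sum_(t < m i) X (r t) * B (s i) t.
Proof.
move=> ri rj.
rewrite ffunE (reindex_onto r (fun u : mindex m => u i)) /=; last first.
  move=> u /forall_inP hu; apply: mindexP => j.
  have [->|ji] := eqVneq j i; first by rewrite ri.
  by rewrite rj // (eqP (hu j ji)).
apply: eq_big => [t|t _]; last by rewrite conform_mx_id ri.
rewrite ri eqxx andbT; apply/forall_inP=> j ji; by rewrite rj.
Qed.
(* An entry addressed by naturals, and [0] out of range. *)
Definition ent (C : pzRingType) p q (B : 'M[C]_(p,q)) (a c : nat) : C :=
  if (insub a : option 'I_p, insub c : option 'I_q) is (Some x, Some y) then B x y else 0.

Lemma entE (C : pzRingType) p q (B : 'M[C]_(p,q)) (a : 'I_p) (c : 'I_q) : ent B a c = B a c.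
Proof. by rewrite /ent !valK. Qed.

Lemma conform_ent (C : pzRingType) p q p' q' (B : 'M[C]_(p,q)) (ep : p = p') (eq : q = q')
   (a : 'I_p') (c : 'I_q') :
  (conform_mx 0 B : 'M_(p',q')) a c = ent B a c.
Proof. by subst; rewrite conform_mx_id entE. Qed.

Lemma mode_prodsE (C : comPzRingType) d (m' p q : 'I_d -> nat) (l : seq 'I_d)
   (B : forall j, 'M[C]_(p j, q j)) (m : 'I_d -> nat) (X : tensor C m) (s : mindex m') :
  uniq l -> (forall j, j \in l -> q j = m j) ->
  (forall j, m' j = if j \in l then p j else m j) ->
  mode_prods l B X s =
  \sum_(u : mindex m | [forall (j | j \notin l), u j == s j :> nat])
     X u * \prod_(j <- l) ent (B j) (s j) (u j).
Proof.
elim: l m X => [|i l IH] m X /=.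
  move=> _ _ _; rewrite ffunE; apply: eq_big => [u|u _]; last by rewrite big_nil mulr1.
  by apply: eq_forallb => j.
case/andP=> il ul hq hm'.
rewrite IH //; first last.
- move=> j; rewrite hm' in_cons /set_size; case: eqP => [->|] //=; by rewrite (negbTE il).
- move=> j jl; rewrite hq ?in_cons ?jl ?orbT // /set_size; case: eqP => // e.
  by rewrite -e jl in il.
pose m1 := set_size m i (p i).
transitivity (\sum_(w : mindex m1 | [forall (j | j \notin l), w j == s j :> nat])
   \sum_(u : mindex m | [forall (j | j != i), u j == w j :> nat])
    (X u * (conform_mx 0 (B i) : 'M[C]_(m1 i, m i)) (w i) (u i)
      * \prod_(j <- l) ent (B j) (s j) (w j))).
  by apply: eq_bigr => w _; rewrite ffunE big_distrl.
rewrite (exchange_big_dep (fun u : mindex m => [forall (j | j \notin i :: l), u j == s j :> nat])) /=; last first.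
  move=> w u /forall_inP hw /forall_inP hu; apply/forall_inP=> j.
  rewrite in_cons negb_or => /andP[ji jl].
  by rewrite (eqP (hu j ji)) hw.
apply: eq_bigr => u /forall_inP hu.
have si : (s i < set_size m i (p i) i)%N.
  by rewrite /set_size eqxx; have := ltn_ord (s i); rewrite [X in (_ < X)%N]hm' mem_head.
have sj j : j != i -> (u j < set_size m i (p i) j)%N.
  by rewrite /set_size => /negbTE ->.
pose f (j : 'I_d) := if j == i then nat_of_ord (s i) else u j.
have fj j : (f j < set_size m i (p i) j)%N.
  by rewrite /f; case: (eqVneq j i) => [->//|/sj].
pose w : mindex (set_size m i (p i)) := [ffun j => Ordinal (fj j)].
have wE j : w j = f j :> nat by rewrite ffunE.
rewrite (big_pred1 w) /=.
  rewrite big_cons -!mulrA; congr (_ * (_ * _)).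
    rewrite conform_ent; first by rewrite wE /f eqxx.
      by rewrite /m1 /set_size eqxx.
    by rewrite hq ?mem_head.
  apply: eq_big_seq => j jl; rewrite wE /f; case: eqP => // e.
  by rewrite -e jl in il.
move=> v /=; apply/andP/eqP => [[/forall_inP h1 /forall_inP h2]|->].
  apply: mindexP => j; rewrite wE /f; case: (eqVneq j i) => [->|ji].
    exact/eqP/h1.
  by rewrite (eqP (h2 j ji)).
split; apply/forall_inP => j; rewrite wE /f.
  move=> jl; case: (eqVneq j i) => [->//|ji].
  by apply: hu; rewrite in_cons negb_or ji.
by move=> /negbTE ->.
Qed.

Theorem vec_mode_prods (C : comPzRingType) d (m p : 'I_d -> nat)
   (B : forall j, 'M[C]_(p j, m j)) (X : tensor C m) :
  vec (mode_prods (enum 'I_d) B X : tensor C p) = kron B *m vec X.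
Proof.
apply/colP => a; rewrite !mxE mode_prodsE ?enum_uniq //; last first.
  by move=> j; rewrite mem_enum.
rewrite (reindex (@vec_mindex d m)) /=; last first.
  exact/onW_bij/vec_mindex_bij.
apply: eq_big => [c|c _].
  by apply/forall_inP => j; rewrite mem_enum.
rewrite mxE kronE mulrC big_enum; congr (_ * _).
by apply: eq_bigr => j _; rewrite entE.
Qed.

Definition sizes_but (d : nat) (i : 'I_d) (p n : 'I_d -> nat) : 'I_d -> nat :=
  fun j => if j != i then p j else n j.

Definition kron_at (C : pzRingType) (d : nat) (n : 'I_d -> nat) (i : 'I_d)
    (A : forall j, 'M[C]_(n j)) : 'M[C]_(kron_size n) :=
  kron (fun j => if j == i then A j else 1%:M).

Definition kron_but (C : pzRingType) (d : nat) (n p : 'I_d -> nat) (i : 'I_d)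
    (V : forall j, 'M[C]_(n j, p j)) :
    'M[C]_(kron_size n, kron_size (sizes_but i p n)) :=
  kron (fun j => if j != i as x return 'M[C]_(n j, if x then p j else n j)
                 then V j else 1%:M).

Section Norms.
Variable C : numClosedFieldType.

Definition norm2 (n : nat) (v : 'cV[C]_n) : C :=
  sqrtC (\sum_a `|v a 0| ^+ 2).

Definition normF (m n : nat) (M : 'M[C]_(m, n)) : C :=
  sqrtC (\sum_a \sum_c `|M a c| ^+ 2).

End Norms.

Section Krylov.
Variable C : numClosedFieldType.

(* A pole is [Some x] for [x] in the field, and [None] for infinity. *)
Definition poles_ok (n k : nat) (A : 'M[C]_n) (xi : k.-tuple (option C)) : Prop :=
  forall x : C, Some x \in xi -> ~~ eigenvalue A x.

(* [Q(A)], for [Q] the product of the [z - x] over the finite poles [x]. *)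
Definition pole_mx (n k : nat) (A : 'M[C]_n) (xi : k.-tuple (option C)) : 'M[C]_n :=
  \prod_(x <- pmap id xi) (A - x%:M).

Definition block_krylov (n b k : nat) (A : 'M[C]_n) (v : 'M[C]_(n, b))
    (xi : k.-tuple (option C)) (W : 'M[C]_(n, b)) : Prop :=
  exists Gamma : 'I_k -> 'M[C]_b,
    W = invmx (pole_mx A xi) *m \sum_(j < k) (A ^+ j *m v *m Gamma j).

(* The span of the columns of all the elements of the block Krylov subspace,
   i.e. the smallest subspace [U] containing them, has dimension [k * b]. *)
Definition full_block_dim (n b k : nat) (A : 'M[C]_n) (v : 'M[C]_(n, b))
    (xi : k.-tuple (option C)) : Prop :=
  exists U : {vspace 'cV[C]_n},
    [/\ forall W, block_krylov A v xi W -> forall c, col c W \in U,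
        forall U' : {vspace 'cV[C]_n},
          (forall W, block_krylov A v xi W -> forall c, col c W \in U') ->
          (U <= U')%VS
      & \dim U = (k * b)%N].

(* [v_j] in [V = [v_1, ..., v_k]] *)
Definition block_col (n b k : nat) (V : 'M[C]_(n, k * b)) (j : 'I_k) : 'M[C]_(n, b) :=
  \matrix_(a, c) V a (mxtens_index (j, c)).

Definition orthonormal_block_basis (n b k : nat) (A : 'M[C]_n) (v : 'M[C]_(n, b))
    (xi : k.-tuple (option C)) (V : 'M[C]_(n, k * b)) : Prop :=
  [/\ V^t* *m V = 1%:M,
      forall j, block_krylov A v xi (block_col V j)
    & forall W, block_krylov A v xi W ->
      exists Gamma : 'I_k -> 'M[C]_b, W = \sum_(j < k) (block_col V j *m Gamma j)].

End Krylov.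

(* Main.v *)
(* Write Q_i for the orthogonal projector Vbar_i Vbar_i^* and P for VV VV^*.
   Since the V_i have orthonormal columns, Q_i Q_j = P for i != j and
   P Q_i = Q_i P = P.  The projected equation says P r = 0, and on the kernel of P
   the product of the 1 - Q_i is 1 - sum_i Q_i, whose terms have mutually
   orthogonal ranges.  This product also kills every Q_i, hence the range of
   A VV, so applied to r it gives chat.  Pythagoras then yields
   |r|^2 = sum_i |Vbar_i^* r|^2 + |chat|^2, and Vbar_i^* r is vec(R_i). *)
Require Import Defs.
From mathcomp Require Import all_boot all_order all_algebra.
From mathcomp Require Import spectral.

Set Implicit Arguments.
Unset Strict Implicit.
Unset Printing Implicit Defensive.

Import GRing.Theory Num.Theory.
Local Open Scope ring_scope.
Local Open Scope sesquilinear_scope.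
Local Open Scope complex_scope.

(** * Mode products as Kronecker matrices acting on [vec] *)

Section KroneckerProducts.
Variable C : comPzRingType.

Lemma eq_kron d (m n : 'I_d -> nat) (B B' : forall j, 'M[C]_(m j, n j)) :
  (forall j, B j = B' j) -> kron B = kron B'.
Proof.
by move=> e; apply/matrixP=> a c; rewrite !kronE; apply: eq_bigr=> j _; rewrite e.
Qed.

Lemma kron1 d (m : 'I_d -> nat) : kron (fun j => 1%:M : 'M[C]_(m j)) = 1%:M.
Proof.
apply/matrixP=> a e; rewrite kronE mxE; case: (eqVneq a e) => [->|ne].
  by rewrite big1 // => j _; rewrite mxE eqxx.
have [j nej] : exists j, vec_mindex a j != vec_mindex e j.
  apply/existsP; apply: contraNT ne => /existsPn h.
  apply/eqP/(@vec_mindex_inj d m)/ffunP => j; exact/eqP/negPn/h.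
by rewrite (bigD1 j) //= mxE (negbTE nej) mul0r.
Qed.

Lemma kron_mul d (m n p : 'I_d -> nat) (B : forall j, 'M[C]_(m j, n j))
    (D : forall j, 'M[C]_(n j, p j)) :
  kron B *m kron D = kron (fun j => B j *m D j).
Proof.
elim: d m n p B D => [|d IH] m n p B D /=; first by rewrite mul1mx.
by rewrite tensmx_mul IH.
Qed.

(* Entrywise, since the sizes need not agree definitionally. *)
Lemma conform_mx1E m m' (a : 'I_m') (c : 'I_m) : m' = m ->
  (conform_mx 0 (1%:M : 'M[C]_m) : 'M_(m', m)) a c = (c == a :> nat)%:R.
Proof.
by move=> e; subst m'; rewrite conform_mx_id mxE [c == a :> nat]eq_sym.
Qed.

(** Each identity factor contributes 1 or 0, so the indices outside [P] must agree. This is the side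
    condition of the sums defining mode products, which thus become full matrix-vector sums. *)
Lemma kron_sparseE d (m m' : 'I_d -> nat) (P : pred 'I_d)
    (M : forall j, 'M[C]_(m' j, m j)) a c :
  (forall j, ~~ P j -> m' j = m j) ->
  kron (fun j => if P j then M j else conform_mx 0 (1%:M : 'M[C]_(m j))) a c =
  if [forall (j | ~~ P j), vec_mindex c j == vec_mindex a j :> nat]
  then \prod_(j | P j) M j (vec_mindex a j) (vec_mindex c j) else 0.
Proof.
move=> hm; rewrite kronE (bigID P) /=; case: forall_inP => h.
  rewrite [X in _ * X]big1 ?mulr1 => [|j nPj].
    by apply: eq_bigr => j ->.
  by rewrite (negbTE nPj) conform_mx1E ?hm // h.
have /forall_inPn[j nPj ne] : ~~ [forall (j | ~~ P j),
    vec_mindex c j == vec_mindex a j :> nat] by apply/forall_inP.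
rewrite [X in _ * X](bigD1 j) //= (negbTE nPj) conform_mx1E ?hm //.
by rewrite (negbTE ne) mul0r mulr0.
Qed.

(** Both branches are conformed because the sizes agree only provably; at mode [i] this is the very
    matrix used in [mode_prod]. *)
Definition mode_mx d (m m' : 'I_d -> nat) (i : 'I_d) p q (B : 'M[C]_(p, q)) j :
    'M[C]_(m' j, m j) :=
  if j == i then conform_mx 0 B else conform_mx 0 (1%:M : 'M[C]_(m j)).

Lemma vec_mode_prod d (m m' : 'I_d -> nat) i p q (B : 'M[C]_(p, q))
    (X : tensor C m) : (forall j, j != i -> m' j = m j) ->
  vec (mode_prod i B X : tensor C m') = kron (mode_mx m m' i B) *m vec X.
Proof.
move=> hm; apply/colP=> a; rewrite !mxE ffunE.
rewrite (reindex (@vec_mindex d m)) /=; last exact/onW_bij/vec_mindex_bij.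
rewrite big_mkcond; apply: eq_bigr => c _.
rewrite mxE /mode_mx.
rewrite (kron_sparseE (P := pred1 i) (fun j => conform_mx 0 B)) //.
by case: ifP; rewrite ?mul0r // big_pred1_eq mulrC.
Qed.

(** Partial families of modes are needed for [Cbar], which skips mode [i]. *)
Lemma vec_mode_prods_seq d (m m' p q : 'I_d -> nat) l
    (B : forall j, 'M[C]_(p j, q j)) (X : tensor C m) :
  uniq l -> (forall j, j \in l -> q j = m j) ->
  (forall j, m' j = if j \in l then p j else m j) ->
  vec (mode_prods l B X : tensor C m') =
  kron (fun j => if j \in l then conform_mx 0 (B j) : 'M_(m' j, m j)
                 else conform_mx 0 (1%:M : 'M[C]_(m j))) *m vec X.
Proof.
move=> ul hq hm; apply/colP=> a; rewrite !mxE mode_prodsE //.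
rewrite (reindex (@vec_mindex d m)) /=; last exact/onW_bij/vec_mindex_bij.
rewrite big_mkcond; apply: eq_bigr => c _; rewrite mxE.
rewrite (kron_sparseE (P := mem l) (fun j => conform_mx 0 (B j))); last first.
  by move=> j /negbTE /= jl; rewrite hm jl.
case: ifP; rewrite ?mul0r // mulrC => _; congr (_ * _).
rewrite big_uniq //=; apply: eq_bigr => j jl.
by rewrite conform_ent ?hq // hm jl.
Qed.

Lemma vecD d (m : 'I_d -> nat) (X Y : tensor C m) : vec (X + Y) = vec X + vec Y.
Proof. by apply/colP=> a; rewrite !mxE ffunE. Qed.

Lemma vecN d (m : 'I_d -> nat) (X : tensor C m) : vec (- X) = - vec X.
Proof. by apply/colP=> a; rewrite !mxE ffunE. Qed.

Lemma vec_sum d (m : 'I_d -> nat) (I : Type) (s : seq I) (P : pred I)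
    (X : I -> tensor C m) :
  vec (\sum_(i <- s | P i) X i) = \sum_(i <- s | P i) vec (X i).
Proof.
apply: (big_morph (@vec C d m) (@vecD d m)).
by apply/colP=> a; rewrite !mxE ffunE.
Qed.

End KroneckerProducts.

(** * Unfoldings, norms and adjoints *)

Lemma unfolding_index_bij d (m : 'I_d -> nat) (i : 'I_d) :
  bijective (fun x : 'I_(m i) * 'I_(lex_size (fun j : 'I_d.-1 => m (lift i j))) =>
    minsert x.1 (lex_mindex x.2)).
Proof.
apply: inj_card_bij => [[t a] [t' a'] /= /ffunP e|].
  have := e i; rewrite !minsert_i => ->; congr pair; apply: lex_mindex_inj.
  by apply/ffunP=> j; have := e (lift i j); rewrite !minsert_lift.
(* Injectivity suffices by counting: [m i] times the product of the other sizes is the product of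
   all sizes. *)
rewrite card_prod !card_ord lex_sizeE card_dep_ffun foldrE big_image /=.
rewrite (eq_bigr m) => [|j _]; last by rewrite card_ord.
by case: d m i => [|d] m i; [case: i | rewrite (bigD1_ord i)].
Qed.

Section Norms.
Variable C : numClosedFieldType.

Lemma norm2_sqr n (v : 'cV[C]_n) : norm2 v ^+ 2 = (v^t* *m v) 0 0.
Proof.
rewrite /norm2 sqrtCK mxE; apply: eq_bigr => a _.
by rewrite !mxE normCK mulrC.
Qed.

(** Both sides sum the squared moduli of all entries of [X]; only the enumeration of the
    multi-indices differs. *)
Lemma normF_unfolding d (m : 'I_d -> nat) (i : 'I_d) (X : tensor C m) :
  normF (unfolding i X) ^+ 2 = norm2 (vec X) ^+ 2.
Proof.
rewrite /normF /norm2 !sqrtCK pair_bigA /=.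
transitivity (\sum_(u : mindex m) `|X u| ^+ 2).
  rewrite (reindex _ (onW_bij _ (unfolding_index_bij m i))) /=.
  by apply: eq_bigr => x _; rewrite mxE.
rewrite (reindex _ (onW_bij _ (vec_mindex_bij m))) /=.
by apply: eq_bigr => a _; rewrite mxE.
Qed.

Lemma adj_mul m n p (A : 'M[C]_(m, n)) (B : 'M[C]_(n, p)) :
  (A *m B)^t* = B^t* *m A^t*.
Proof. by rewrite trmx_mul map_mxM. Qed.

Lemma adj1 n : (1%:M : 'M[C]_n)^t* = 1%:M.
Proof. by rewrite trmx1 map_mx1. Qed.

Lemma adjD m n (A B : 'M[C]_(m, n)) : (A + B)^t* = A^t* + B^t*.
Proof. by apply/matrixP=> a c; rewrite !mxE rmorphD. Qed.

Lemma adjK m n (A : 'M[C]_(m, n)) : A^t*^t* = A.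
Proof. by apply/matrixP=> a c; rewrite !mxE conjCK. Qed.

Lemma adj_kron d (m n : 'I_d -> nat) (B : forall j, 'M[C]_(m j, n j)) :
  (kron B)^t* = kron (fun j => (B j)^t*).
Proof.
apply/matrixP=> a c; rewrite !mxE !kronE rmorph_prod.
by apply: eq_bigr => j _; rewrite !mxE.
Qed.

End Norms.

(** * Products of complementary projectors, and Pythagoras *)

Section ProjectorFamily.
Variables (C : numClosedFieldType) (N : nat) (I : eqType) (Q : I -> 'M[C]_N).
Variable P : 'M[C]_N.
Hypothesis QQ : forall i, Q i *m Q i = Q i.
Hypothesis QQ' : forall i j, i != j -> Q i *m Q j = P.
Hypothesis QP : forall i, Q i *m P = P.
Hypothesis PQ : forall i, P *m Q i = P.

(** Every cross term contains some [Q i *m Q j *m x] with [i != j], that is [P *m x = 0];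
    distinctness comes from [uniq s]. *)
Lemma prod_compl_annihilated q (x : 'M[C]_(N, q)) (s : seq I) : uniq s ->
  P *m x = 0 ->
  (\prod_(i <- s) (1%:M - Q i)) *m x = x - \sum_(i <- s) Q i *m x.
Proof.
move=> us Px; elim: s us => [|i s IH] /=; first by rewrite !big_nil subr0 mul1mx.
case/andP=> nis us; rewrite !big_cons -mulmxA IH // mulmxBl mul1mx.
rewrite mulmxBr mulmx_sumr [X in _ - (_ - X)]big1_seq => [|j /= js].
  by rewrite subr0 opprD addrA addrAC.
rewrite mulmxA QQ' ?Px //; apply: contraNneq nis => -> //.
Qed.

(** The last factor alone kills [P], since [Q i *m P = P]. *)
Lemma prod_compl_P (s : seq I) : s != [::] ->
  (\prod_(i <- s) (1%:M - Q i)) *m P = 0.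
Proof.
case/lastP: s => // s i _.
by rewrite -cats1 big_cat big_seq1 /= -mulmxA mulmxBl QP mul1mx subrr mulmx0.
Qed.

Lemma prod_compl_Q (s : seq I) i : uniq s -> i \in s -> P *m P = P ->
  (\prod_(i <- s) (1%:M - Q i)) *m Q i = 0.
Proof.
move=> us si PP; have s0 : s != [::] by case: s si {us}.
(* Split [Q i] as [(Q i - P) + P]. The product kills [P], and [P] kills [Q i - P], so the expansion
   without cross terms applies to the latter; there only the term of index [i] survives, and it
   cancels [Q i - P]. *)
rewrite -[Q i in LHS](subrK P) mulmxDr prod_compl_P // addr0.
rewrite prod_compl_annihilated //; last by rewrite mulmxBr PQ PP subrr.
rewrite (bigD1_seq i) //= mulmxBr QQ QP big1 ?addr0 ?subrr // => j ji.
by rewrite mulmxBr QQ' // QP subrr.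
Qed.

End ProjectorFamily.

Lemma norm2_split (C : numClosedFieldType) (N : nat) (I : finType)
    (M : I -> nat) (W : forall i, 'M[C]_(N, M i)) (P : 'M[C]_N) (x : 'cV[C]_N) :
  (forall i, (W i)^t* *m W i = 1%:M) ->
  (forall i j, i != j -> W i *m (W i)^t* *m (W j *m (W j)^t*) = P) ->
  P *m x = 0 ->
  norm2 x ^+ 2 = \sum_i norm2 ((W i)^t* *m x) ^+ 2 +
    norm2 (x - \sum_i W i *m (W i)^t* *m x) ^+ 2.
Proof.
move=> WW WW' Px; set e := x - _.
have We i : (W i)^t* *m e = 0.
  rewrite mulmxBr mulmx_sumr (bigD1 i) //= !mulmxA WW mul1mx.
  rewrite big1 ?addr0 ?subrr // => j ji.
  have := WW' i j; rewrite eq_sym => /(_ ji) WWij.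
  (* Inserting [(W i)^t* *m W i = 1] on the left makes the product of the two projectors appear; it
     is [P], which kills [x]. *)
  rewrite -[(W i)^t*]mul1mx -(WW i) -!mulmxA ![W i *m _]mulmxA.
  rewrite [W j *m (_ *m _)]mulmxA [W i *m (W i)^t* *m (_ *m _)]mulmxA WWij.
  by rewrite Px mulmx0.
pose S := \sum_i W i *m (W i)^t* *m x.
have xE : x = S + e by rewrite addrC subrK.
have eS : e^t* *m S = 0.
  rewrite mulmx_sumr big1 // => i _.
  by rewrite !mulmxA -[e^t* *m W i]adjK adj_mul adjK We trmx0 map_mx0 !mul0mx.
have Se : S^t* *m e = 0 by rewrite -[_ *m e]adjK adj_mul adjK eS trmx0 map_mx0.
have xS : x^t* *m S = \sum_i ((W i)^t* *m x)^t* *m ((W i)^t* *m x).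
  by rewrite mulmx_sumr; apply: eq_bigr => i _; rewrite adj_mul adjK !mulmxA.
have xe : x^t* *m e = e^t* *m e.
  by rewrite {1}xE adjD mulmxDl Se add0r.
(* Only the right-hand copy of [x] is split into [S + e], which avoids expanding the double sum in
   [S^t* *m S]. *)
rewrite !norm2_sqr {2}xE mulmxDr xS xe mxE summxE; congr (_ + _).
by apply: eq_bigr => i _; rewrite norm2_sqr.
Qed.

(** * The residual identity, checked mode by mode on Kronecker factors *)

Theorem corollary3p8 (R : realType) (d : nat) (n b k : 'I_d -> nat)
    (A : forall i, 'M[R[i]]_(n i)) (Cf : forall i, 'M[R[i]]_(n i, b i))
    (xi : forall i, (k i).-tuple (option R[i]))
    (V : forall i, 'M[R[i]]_(n i, k i * b i))
    (C : tensor R[i] n) (Y : tensor R[i] (fun i => k i * b i)%N) :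
  (2 <= d)%N ->
  (forall i, poles_ok (A i) (xi i)) ->
  (forall i, full_block_dim (A i) (Cf i) (xi i)) ->
  (forall i, orthonormal_block_basis (A i) (Cf i) (xi i) (V i)) ->
  let p := fun i => (k i * b i)%N in
  let Ak := fun i => (V i)^t* *m A i *m V i in
  \sum_(i < d) mode_prod i (Ak i) Y
    = mode_prods (enum 'I_d) (fun i => (V i)^t*) C :> tensor R[i] p ->
  let c := vec C in
  let y := vec Y in
  let VV := kron V in
  let AA := \sum_(i < d) kron_at i A in
  let r := c - AA *m VV *m y in
  let Vbar := fun i => kron_but i V in
  let Cbar := fun i =>
    mode_prods [seq j <- enum 'I_d | j != i] (fun j => (V j)^t*) C
      : tensor R[i] (sizes_but i p n) in
  let Ybar := fun i => mode_prod i (V i) Y : tensor R[i] (sizes_but i p n) in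
  let Rt := fun i =>
    Cbar i - mode_prod i (A i) (Ybar i)
      - \sum_(j < d | j != i) mode_prod j (Ak j) (Ybar i)
      : tensor R[i] (sizes_but i p n) in
  let chat := (\prod_(i < d) (1%:M - Vbar i *m (Vbar i)^t*)) *m c in
  norm2 r ^+ 2 = \sum_(i < d) normF (unfolding i (Rt i)) ^+ 2 + norm2 chat ^+ 2
  /\ ((exists z, c = VV *m z) -> chat = 0).
Proof.
move=> d2 _ _ hV p Ak hY c y VV AA r Vbar Cbar Ybar Rt chat.
have VtV i : (V i)^t* *m V i = 1%:M by case: (hV i).
pose P := VV *m VV^t*.
pose Q i := Vbar i *m (Vbar i)^t*.
have WW i : (Vbar i)^t* *m Vbar i = 1%:M.
  rewrite /Vbar /kron_but adj_kron kron_mul -kron1; apply: eq_kron => j.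
  by rewrite /sizes_but; case: (j != i); rewrite ?VtV // adj1 mul1mx.
have VVV : VV^t* *m VV = 1%:M.
  by rewrite /VV adj_kron kron_mul -kron1; apply: eq_kron => j; rewrite VtV.
have QE i : Q i = kron (fun j => if j != i then V j *m (V j)^t* else 1%:M).
  rewrite /Q /Vbar /kron_but adj_kron kron_mul; apply: eq_kron => j.
  by rewrite /sizes_but; case: (j != i); rewrite // adj1 mul1mx.
have PE : P = kron (fun j => V j *m (V j)^t*).
  by rewrite /P /VV adj_kron kron_mul.
have PjK j : V j *m (V j)^t* *m (V j *m (V j)^t*) = V j *m (V j)^t*.
  by rewrite -mulmxA [(V j)^t* *m _]mulmxA VtV mul1mx.
have QQ i : Q i *m Q i = Q i.
  by rewrite /Q -mulmxA [(Vbar i)^t* *m _]mulmxA WW mul1mx.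
have PP : P *m P = P by rewrite /P -mulmxA [VV^t* *m _]mulmxA VVV mul1mx.
have QQ' i j : i != j -> Q i *m Q j = P.
  (* As [i != j], every mode receives [V l *m (V l)^t*] from at least one of the two products. *)
  move=> ij; rewrite !QE PE kron_mul; apply: eq_kron => l.
  case: (eqVneq l i) => [->|_] /=; first by rewrite ij mul1mx.
  by case: (l != j); rewrite ?mulmx1.
have QVV i : Q i *m VV = VV.
  rewrite QE kron_mul; apply: eq_kron => l.
  by case: (l != i); rewrite ?mul1mx // -mulmxA VtV mulmx1.
have QP i : Q i *m P = P by rewrite /P mulmxA QVV.
have PQ i : P *m Q i = P.
  rewrite PE QE kron_mul; apply: eq_kron => l.
  by case: (l != i); rewrite ?PjK ?mulmx1.
have uI := index_enum_uniq 'I_d.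
(* [d2] provides a mode, so the product defining [chat] has at least one factor. *)
have i0 : 'I_d by exact: Ordinal (ltnW d2).
have sI : index_enum 'I_d != [::].
  by have := mem_index_enum i0; case: (index_enum _).
split; last first.
  (* If [c = VV *m z], then [c] lies in the range of [P], which the product kills. *)
  have PVV : VV = P *m VV by rewrite -mulmxA VVV mulmx1.
  case=> z cz; rewrite /chat cz PVV -mulmxA [LHS]mulmxA.
  by rewrite (prod_compl_P QP sI) mul0mx.
(* [A i] acts in the one mode where [Q i] is the identity; in the others, [V l *m (V l)^t*] fixes
   [V l]. *)
have QA i : Q i *m (kron_at i A *m VV) = kron_at i A *m VV.
  rewrite QE /kron_at !kron_mul; apply: eq_kron => l.
  case: (eqVneq l i) => [->|_]; rewrite ?mul1mx //=.
  by rewrite -mulmxA VtV mulmx1.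
have hVA i : VV^t* *m (kron_at i A *m VV) = kron (mode_mx p p i (Ak i)).
  rewrite /VV /kron_at adj_kron !kron_mul; apply: eq_kron => l.
  rewrite /mode_mx; case: (eqVneq l i) => [->|_]; rewrite conform_mx_id ?mul1mx //.
  by rewrite mulmxA.
(* Galerkin condition: vectorizing the projected equation gives [VV^t* *m c], and [hVA] matches its
   terms with those of [VV^t* *m AA *m VV *m y]. *)
have Px : P *m r = 0.
  rewrite /P -mulmxA [VV^t* *m r]mulmxBr.
  have /(congr1 (@vec _ _ _)) := hY.
  rewrite vec_sum vec_mode_prods -/c -adj_kron -/VV => <-.
  rewrite -mulmxA mulmx_suml mulmx_sumr -sumrB big1 ?mulmx0 // => i _.
  by rewrite vec_mode_prod // -hVA !mulmxA subrr.
have chatE : chat = r - \sum_i Q i *m r.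
  (* It remains to see that the product kills [AA *m VV *m y]: by [QA], each summand lies in the
     range of some [Q i]. *)
  rewrite -(prod_compl_annihilated QQ' uI Px) /chat /r mulmxBr -[LHS]subr0.
  congr (_ - _); rewrite -[AA *m _ *m _]mulmxA [AA *m _]mulmx_suml mulmx_sumr.
  rewrite big1 // => i _; rewrite [kron_at i A *m _]mulmxA -QA -[Q i *m _ *m _]mulmxA.
  have E0 := prod_compl_Q QQ QQ' QP PQ uI (mem_index_enum i) PP.
  by rewrite [LHS]mulmxA E0 mul0mx.
have CE i : vec (Cbar i) = (Vbar i)^t* *m c.
  rewrite vec_mode_prods_seq ?filter_uniq ?enum_uniq //; last first.
    by move=> j; rewrite mem_filter mem_enum andbT.
  rewrite /Vbar /kron_but adj_kron; congr (_ *m _); apply: eq_kron => j.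
  rewrite mem_filter mem_enum andbT /sizes_but.
  by case: (j != i); rewrite conform_mx_id ?adj1.
have size_p i j : j != i -> sizes_but i p n j = p j by rewrite /sizes_but => ->.
have AiE i : vec (mode_prod i (A i) (Ybar i) : tensor R[i] (sizes_but i p n)) =
    (Vbar i)^t* *m (kron_at i A *m VV) *m y.
  rewrite vec_mode_prod // vec_mode_prod; last exact: size_p.
  rewrite mulmxA; congr (_ *m y).
  (* Mode [i] gives [A i *m V i] on both sides; elsewhere [(V j)^t* *m V j = 1]. *)
  rewrite /Vbar /kron_but /kron_at /VV adj_kron !kron_mul; apply: eq_kron => j.
  rewrite /mode_mx /sizes_but; case: (eqVneq j i) => [->|_] /=.
    by rewrite !conform_mx_id adj1 mul1mx.
  by rewrite !conform_mx_id !mul1mx VtV.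
have AjE i j : j != i ->
    vec (mode_prod j (Ak j) (Ybar i) : tensor R[i] (sizes_but i p n)) =
    (Vbar i)^t* *m (kron_at j A *m VV) *m y.
  move=> ji; rewrite vec_mode_prod // vec_mode_prod; last exact: size_p.
  rewrite mulmxA; congr (_ *m y).
  (* Mode [i] keeps the [V i] of [Ybar i], mode [j] compresses [A j] to [Ak j], and all other modes
     reduce to the identity. *)
  rewrite /Vbar /kron_but /kron_at /VV adj_kron !kron_mul; apply: eq_kron => l.
  rewrite /mode_mx /sizes_but; case: (eqVneq l i) => [->|_] /=.
    by rewrite eq_sym (negbTE ji) !conform_mx_id adj1 !mul1mx.
  case: (eqVneq l j) => [->|_]; rewrite !conform_mx_id ?mulmx1 ?mul1mx ?VtV //.
  by rewrite mulmxA.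
have RE i : vec (Rt i) = (Vbar i)^t* *m r.
  rewrite /Rt !(vecD, vecN, vec_sum) CE AiE mulmxBr -addrA -opprD; congr (_ - _).
  (* Isolate the summand of [AA] at mode [i]: it carries the full [A i], the others the compressed
     [Ak j]. *)
  rewrite -[AA *m _ *m _]mulmxA [AA *m _]mulmx_suml mulmx_sumr [RHS](bigD1 i) //=.
  rewrite !mulmxA; congr (_ + _); apply: eq_bigr => j ji.
  by rewrite AjE // !mulmxA.
rewrite chatE (norm2_split WW QQ' Px); congr (_ + _).
by apply: eq_bigr => i _; rewrite normF_unfolding RE.
Qed.
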